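(* Consider the $q$-difference equation $$(a_{-,2}x^2+a_{-,1}x+a_{-,0})g(x/q)+(a_{+,2}x^2+a_{+,1}x+a_{+,0})g(qx)+(a_{0,2}x^2+a_{0,1}x+a_{0,0})g(x)=0$$ and set $q=1+\varepsilon$. By Taylor's expansions $$g(x/q)=g(x)+(-\varepsilon+\varepsilon^2)xg'(x)+\varepsilon^2x^2g''(x)/2+O(\varepsilon^3),\qquad g(qx)=g(x)+\varepsilon xg'(x)+\varepsilon^2x^2g''(x)/2+O(\varepsilon^3),$$ the equation becomes $$\{(a_{-,2}+a_{+,2}+a_{0,2})x^2+(a_{-,1}+a_{+,1}+a_{0,1})x+(a_{-,0}+a_{+,0}+a_{0,0})\}g(x)$$ $$+\varepsilon\{(a_{+,2}-a_{-,2})x^2+(a_{+,1}-a_{-,1})x+(a_{+,0}-a_{-,0})\}xg'(x)$$ $$+\varepsilon^2\{(a_{+,2}+a_{-,2})x^2+(a_{+,1}+a_{-,1})x+(a_{+,0}+a_{-,0})\}x^2g''(x)/2$$ $$+(a_{-,2}x^2+a_{-,1}x+a_{-,0})\varepsilon^2xg'(x)+O(\varepsilon^3)=0.$$ If there exist constants $b_i,b_{i,1},b_{i,0}$ ($i=0,1,2$) such that, for each $i=0,1,2$, $$\frac{a_{-,i}+a_{+,i}+a_{0,i}}{\varepsilon^2}\to b_{i,0},\qquad \frac{a_{+,i}-a_{-,i}}{\varepsilon}\to b_{i,1},\qquad \frac{a_{+,i}+a_{-,i}}{2}\to b_i$$ as $\varepsilon\to0$, then $a_{+,i}\to b_i$,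 $a_{-,i}\to b_i$, $a_{0,i}\to-2b_i$ ($i=0,1,2$) as $\varepsilon\to0$, and we obtain the differential equation $$x^2(b_2x^2+b_1x+b_0)g''(x)+x\{(b_{2,1}+b_2)x^2+(b_{1,1}+b_1)x+(b_{0,1}+b_0)\}g'(x)+(b_{2,0}x^2+b_{1,0}x+b_{0,0})g(x)=0.$$
   Context: The coefficients $a_{\pm,i},a_{0,i}$ ($i=0,1,2$) may depend on $\varepsilon=q-1$. The passage from the $q$-difference equation to the differential equation is the formal limit $\varepsilon\to0$ (that is, $q\to1$) based on the Taylor expansion in $\varepsilon$.
   Formalization: The formal statement assumes g is three times differentiable on an open set (real or complex), and, for the expansion with O(ε³) only, that a_{-,i} and a_{+,i} stay bounded as ε→0; that expansion is false for unbounded coefficients such as a_{-,0}=ε^{-5}. *)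

(* Defs.v *)
From HB Require Import structures.
From mathcomp Require Import all_boot all_order all_algebra.
From mathcomp Require Import complex.
From mathcomp Require Import all_classical all_reals all_analysis.
Set Implicit Arguments.
Unset Strict Implicit.
Unset Printing Implicit Defensive.
Import Order.TTheory GRing.Theory Num.Theory.
Import numFieldNormedType.Exports.
Local Open Scope ring_scope.
Local Open Scope classical_set_scope.

(* The base field is either the reals or the complex numbers; derivatives and
   limits below are taken over [K], hence are complex ones in the second
   case. *)
Variant real_or_complex : numFieldType -> Prop :=
| RealBase (R : realType) : real_or_complex R
| ComplexBase (R : realType) : real_or_complex (R[i])%C.

(* On an open subset of the complex plane this is the same as holomorphy. *)
Definition derivable3 (K : numFieldType) (D : set K) (g : K -> K) : Prop :=
  forall x, D x ->
    [/\ derivable g x 1, derivable (derive1 g) x 1 & derivable (derive1n 2 g) x 1].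

Definition quadpol (K : numFieldType) (c : 'I_3 -> K) (x : K) : K :=
  \sum_(i < 3) c i * x ^+ i.

(* Coefficient families are indexed first by e = q - 1, then by the degree
   in x. *)
Definition qdiff_lhs (K : numFieldType) (am ap a0 : K -> 'I_3 -> K)
    (g : K -> K) (e x : K) : K :=
  let q := 1 + e in
  quadpol (am e) x * g (x / q) + quadpol (ap e) x * g (q * x)
  + quadpol (a0 e) x * g x.

Definition taylor_div (K : numFieldType) (g : K -> K) (e x : K) : K :=
  g x + (- e + e ^+ 2) * x * derive1 g x + e ^+ 2 * x ^+ 2 * derive1n 2 g x / 2.

Definition taylor_mul (K : numFieldType) (g : K -> K) (e x : K) : K :=
  g x + e * x * derive1 g x + e ^+ 2 * x ^+ 2 * derive1n 2 g x / 2.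

Definition expanded_lhs (K : numFieldType) (am ap a0 : K -> 'I_3 -> K)
    (g : K -> K) (e x : K) : K :=
  quadpol (fun i => am e i + ap e i + a0 e i) x * g x
  + e * quadpol (fun i => ap e i - am e i) x * x * derive1 g x
  + e ^+ 2 * quadpol (fun i => ap e i + am e i) x * x ^+ 2 * derive1n 2 g x / 2
  + quadpol (am e) x * e ^+ 2 * x * derive1 g x.

Definition ode_lhs (K : numFieldType) (b b1 b0 : 'I_3 -> K)
    (g : K -> K) (x : K) : K :=
  x ^+ 2 * quadpol b x * derive1n 2 g x
  + x * quadpol (fun i => b1 i + b i) x * derive1 g x
  + quadpol b0 x * g x.

(* Main.v *)
Require Import Defs.
From HB Require Import structures.
From mathcomp Require Import all_boot all_order all_algebra.
From mathcomp Require Import complex.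
From mathcomp Require Import all_classical all_reals all_analysis.
From mathcomp Require Import ring.
Set Implicit Arguments.
Unset Strict Implicit.
Unset Printing Implicit Defensive.
Import Order.TTheory GRing.Theory Num.Theory.
Import numFieldNormedType.Exports.
Local Open Scope ring_scope.
Local Open Scope classical_set_scope.

(* The only analytic input is the mean value inequality
   [|F (a + h) - F a| <= sup |F'| * |h|] along segments, which holds over the
   reals and over the complex numbers. As g'' is differentiable at x, its
   increment g''(x + h) - g''(x) is O(h); two applications of the inequality
   turn this into the O(h^3) Taylor estimate for g, with neither continuity of
   g''' nor a Cauchy formula. The increments of the two arguments are
   x q - x = x e and x / q - x = - x e / (1 + e), the latter being
   x (- e + e^2) up to O(e^3). *)

(** * Derivatives and the mean value inequality *)

Lemma is_derive1_cvgP (K : numFieldType) (f : K -> K) (x d : K) :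
  is_derive x 1 f d <-> (f (x + k) - f x) / k @[k --> 0^'] --> d.
Proof.
have E : (fun k : K => (f (x + k) - f x) / k) =
         (fun k => k^-1 *: ((f \o shift x) (k *: 1) - f x)).
  apply/funext => k; rewrite /= /GRing.scale /= mulr1 mulrC.
  by rewrite (addrC x).
rewrite E; split => [fd|fd].
  by rewrite -(@derive_val _ _ _ _ _ _ _ fd); exact: ex_derive.
have fc : derivable f x 1 by apply/cvg_ex; exists d.
by split => //; exact: (cvg_lim _ fd).
Qed.

(** Multiplying by [k] removes the quotient, so the estimate holds on a full neighbourhood, [k = 0]
    included, and can be transported through [rho] and along a segment. *)
Lemma is_derive1P (K : numFieldType) (f : K -> K) (x d : K) :
  is_derive x 1 f d <->
  (forall eps, 0 < eps ->
    \forall k \near 0, `|f (x + k) - f x - d * k| <= eps * `|k|).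
Proof.
have E (k : K) : k != 0 ->
    `|f (x + k) - f x - d * k| = `|d - (f (x + k) - f x) / k| * `|k|.
  by move=> k0; rewrite -normrM mulrBl divfK// distrC.
rewrite is_derive1_cvgP; split => [/cvgrPdist_le fd eps eps0|fd].
  have := fd _ eps0; rewrite near_withinE; apply: filterS => k fk.
  have [->|k0] := eqVneq k 0; first by rewrite addr0 subrr mulr0 subr0 normr0 mulr0.
  by rewrite E// ler_wpM2r// fk.
apply/cvgrPdist_le => eps eps0; rewrite near_withinE.
apply: filterS (fd _ eps0) => k fk k0.
by move: fk; rewrite E// ler_pM2r// normr_gt0.
Qed.

(* [iota] and [rho] stand for the inclusion of the reals in [K] and for the
   real part; a segment in [K] is then handled by the real mean value theorem
   applied to the projection on the direction of [F (a + h) - F a]. *)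
Lemma mean_value_projection (R : realType) (K : numFieldType)
    (iota : {rmorphism R -> K}) (rho : K -> R)
    (iota_le : forall s t, (iota s <= iota t) = (s <= t))
    (iota_norm : forall t, `|iota t| = iota `|t|)
    (rhoB : forall y z, rho (y - z) = rho y - rho z)
    (rhoZ : forall t z, rho (iota t * z) = t * rho z)
    (rho_le : forall z, iota `|rho z| <= `|z|)
    (rho_dir : forall z, exists2 c, `|c| <= 1 & iota (rho (c * z)) = `|z|)
    (F F' : K -> K) (a h M : K) :
  (forall t : K, 0 <= t <= 1 -> is_derive (a + t * h) 1 F (F' (a + t * h))) ->
  (forall t : K, 0 <= t <= 1 -> `|F' (a + t * h)| <= M) ->
  `|F (a + h) - F a| <= M * `|h|.
Proof.
move=> dF F'M.
(* The factor [c] turns the increment of [F] towards the real axis, so that applying [rho] loses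
   nothing of its norm. *)
have [c c1 cE] := rho_dir (F (a + h) - F a).
have iota_lt s t : (iota s < iota t) = (s < t).
  by rewrite !lt_neqAle iota_le fmorph_eq.
have iota01 t : 0 <= t <= 1 -> 0 <= iota t <= 1.
  rewrite -[X in X <= iota t](rmorph0 iota) -[X in iota t <= X](rmorph1 iota).
  by rewrite !iota_le.
(* The denominator is [|h| + 1] rather than [|h|] because [h] may be 0. *)
have h1 : 0 < `|h| + 1 by rewrite ltr_wpDl.
pose phi t := rho (c * F (a + iota t * h)).
pose dphi t := rho (c * (F' (a + iota t * h) * h)).
have dphiP (t : R) : 0 <= t <= 1 -> is_derive t 1 phi (dphi t).
  move=> t01; apply/is_derive1P => eps eps0.
  have eta0 : 0 < iota eps / (`|h| + 1).
    by rewrite divr_gt0// -(rmorph0 iota) iota_lt.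
  have /is_derive1P/(_ _ eta0)/nbhs_ballP[d /= d0 dP] := dF _ (iota01 _ t01).
  (* The admissible radius [d / (|h| + 1)] lies in [K], whereas [phi] needs a real one. Being
     positive, it equals its own norm, and [rho_dir] exhibits a norm as [iota r] with [r] real. *)
  have [c' _ +] := rho_dir (d / (`|h| + 1)).
  have dh0 : 0 < d / (`|h| + 1) by rewrite divr_gt0.
  rewrite (gtr0_norm dh0); set r := rho _ => rE.
  apply/nbhs_ballP; exists r => /=; first by rewrite -iota_lt rE rmorph0.
  move=> s; rewrite /ball/= sub0r normrN => sr.
  have sE : a + iota (t + s) * h = a + iota t * h + iota s * h.
    by rewrite rmorphD mulrDl addrA.
  have -> : phi (t + s) - phi t - dphi t * s =
      rho (c * (F (a + iota t * h + iota s * h) - F (a + iota t * h) -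
           F' (a + iota t * h) * (iota s * h))).
    rewrite /phi /dphi sE 2!mulrBr !rhoB; congr (_ - _).
    by rewrite mulrC -rhoZ; congr (rho _); ring.
  rewrite -iota_le (le_trans (rho_le _))// normrM.
  rewrite (le_trans (ler_wpM2r _ c1))// mul1r.
  have shd : `|iota s * h| <= iota `|s| * (`|h| + 1).
    by rewrite normrM iota_norm ler_wpM2l ?lerDl// -iota_norm.
  have := dP (iota s * h); rewrite /ball/= sub0r normrN => /(_ _)/le_trans -> //.
    by rewrite (le_lt_trans shd)// -ltr_pdivlMr// -rE iota_lt.
  have ieps0 : 0 <= iota eps by rewrite -(rmorph0 iota) iota_le ltW.
  by rewrite rmorphM/= -mulrA (ler_wpM2l ieps0)// (ler_pdivrMl _ _ h1) [leRHS]mulrC.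
have phic : {within `[0, 1], continuous phi}.
  apply: derivable_within_continuous => t; rewrite in_itv/= => t01.
  by have := dphiP _ t01 => ?; exact: ex_derive.
have [|t t01 tE] := @MVT_segment R phi dphi 0 1 ler01 _ phic.
  by move=> t; rewrite in_itv/= => /andP[/ltW t0 /ltW t1]; apply: dphiP; rewrite t0.
rewrite -cE mulrBr rhoB.
have : rho (c * F (a + h)) - rho (c * F a) = dphi t.
  by move: tE; rewrite subr0 mulr1 /phi rmorph1 rmorph0 mul1r mul0r addr0.
rewrite /= => ->.
have {}t01 : 0 <= t <= 1 by move: t01; rewrite in_itv.
rewrite (@le_trans _ _ (iota `|dphi t|)) ?iota_le ?ler_norm//.
rewrite (le_trans (rho_le _))// !normrM (le_trans (ler_wpM2r _ c1))// ?mulr_ge0//.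
by rewrite mul1r ler_wpM2r// F'M// iota01.
Qed.

(** Over the reals both maps are the identity; over the complex numbers they are the embedding of
    the reals and the real part. *)
Lemma norm_increment_le (K : numFieldType) (hK : real_or_complex K)
    (F F' : K -> K) (a h M : K) :
  (forall t : K, 0 <= t <= 1 -> is_derive (a + t * h) 1 F (F' (a + t * h))) ->
  (forall t : K, 0 <= t <= 1 -> `|F' (a + t * h)| <= M) ->
  `|F (a + h) - F a| <= M * `|h|.
Proof.
case: hK F F' a h M => R F F' a h M.
  apply: (@mean_value_projection R R idfun idfun) => // z.
  (* The direction of a real number is its sign. *)
  exists (Num.sg z); last by rewrite /= -normrEsg.
  by rewrite normr_sg lern1 leq_b1.
apply: (@mean_value_projection R _ (real_complex R) (@complex.Re R)).
- by move=> s t; rewrite lecR.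
- by move=> t; rewrite normc_def/= expr0n addr0 sqrtr_sqr.
- by move=> [? ?] [? ?].
- by move=> t [u v]; rewrite /= mul0r subr0.
- by move=> z; exact: normc_ge_Re.
move=> z; have [->|z0] := eqVneq z 0; first by exists 0; rewrite ?normr0// mulr0.
have nz0 : `|z| != 0 by rewrite normr_eq0.
(* The product of [z] with its conjugate is [|z|^2], hence this unit factor sends [z] to [|z|]. *)
exists (z^*%C / `|z|).
  by rewrite normrM normfV normr_id normcJ divff.
by rewrite mulrAC (mulrC _ z) -sqr_normc expr2 mulfK//.
Qed.

(** A ball contains the segment from its centre to any of its points, and [|t * h| <= |h|] on it;
    the bound on [F'] at [h] thus serves on the whole segment, and the mean value inequality adds
    one power of [|h|] with the same constant. *)
Lemma norm_increment_le_near (K : numFieldType) (hK : real_or_complex K)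
    (F F' : K -> K) (x C : K) (n : nat) : 0 <= C ->
  (\forall h \near 0, is_derive (x + h) 1 F (F' (x + h))) ->
  (\forall h \near 0, `|F' (x + h)| <= C * `|h| ^+ n) ->
  \forall h \near 0, `|F (x + h) - F x| <= C * `|h| ^+ n.+1.
Proof.
move=> C0 dF F'C.
have [d /= d0 dP] := (@nbhs_ballP _ K _ _).1 (filterI dF F'C).
apply/(@nbhs_ballP K K); exists d => //= h.
rewrite /ball/= sub0r normrN => hd.
have thd (t : K) : 0 <= t <= 1 -> `|t * h| <= `|h|.
  by move=> /andP[t0 t1]; rewrite normrM ler_piMl// ger0_norm.
have thB (t : K) : 0 <= t <= 1 -> ball 0 d (t * h).
  by move=> t01; rewrite /ball/= sub0r normrN (le_lt_trans (thd _ t01)).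
rewrite exprSr mulrA; apply: (norm_increment_le hK (F' := F')) => t t01.
  exact: (dP _ (thB _ t01)).1.
apply: le_trans (dP _ (thB _ t01)).2 _.
by rewrite ler_wpM2l// lerXn2r ?nnegrE// thd.
Qed.

(** * The third-order Taylor estimate *)

Lemma derive1_is_derive (K : numFieldType) (f : K -> K) (x : K) :
  derivable f x 1 -> is_derive x 1 f (derive1 f x).
Proof. by move=> fx; rewrite derive1E; exact: derivableP. Qed.

Lemma taylor3 (K : numFieldType) (hK : real_or_complex K) (D : set K)
    (hD : open D) (g : K -> K) (hg : derivable3 D g) (x : K) : D x ->
  exists2 C : K, 0 < C & \forall h \near 0,
    `|g (x + h) - g x - derive1 g x * h - derive1n 2 g x * h ^+ 2 / 2|
      <= C * `|h| ^+ 3.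
Proof.
move=> Dx.
have nD : \forall h \near (0 : K), D (x + h).
  have /nbhs_ballP[d /= d0 dP] : nbhs x D by exact: hD.
  apply/nbhs_ballP; exists d => //= h; rewrite /ball/= sub0r normrN => hd.
  by apply: dP; rewrite /ball/= opprD addrA subrr sub0r normrN.
pose g1 := derive1 g; pose g2 := derive1n 2 g.
(* These are the Taylor polynomials to be subtracted, up to their constant term: [b = 0] for [g1],
   and [b = g2 x / 2] for [g]. *)
have dpoly (a b z : K) :
    is_derive z 1 (fun y => a * (y - x) + b * (y - x) ^+ 2) (a + b * 2 * (z - x)).
  have -> : (fun y => a * (y - x) + b * (y - x) ^+ 2) =
      a \*: (id - cst x) + b \*: (id - cst x) ^+ 2.
    by apply/funext.
  by apply: is_derive_eq; rewrite !fctE /GRing.scale/= subr0 expr1; ring.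
have [C C0 g3P] : exists2 C : K, 0 < C &
    \forall h \near 0, `|g2 (x + h) - g2 x| <= C * `|h| ^+ 1.
  (* Differentiability of [g2] at [x] is used with tolerance 1, whence the constant [1 + |g3|]. *)
  have [_ _ /derive1_is_derive/is_derive1P/(_ _ ltr01)] := hg x Dx.
  set g3 := derive1 _ x => g3P; exists (1 + `|g3|); first by rewrite ltr_pwDl.
  apply: filterS g3P => h hP; rewrite expr1 mulrDl -normrM.
  by rewrite -[X in `|X|](subrK (g3 * h)) (le_trans (ler_normD _ _))// lerD2r.
have R1 : \forall h \near 0, `|g1 (x + h) - g1 x - g2 x * h| <= C * `|h| ^+ 2.
  have dR : \forall h \near 0, is_derive (x + h) 1
      (fun y => g1 y - (g2 x * (y - x) + 0 * (y - x) ^+ 2))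
      (g2 (x + h) - g2 x).
    apply: filterS nD => h /hg[_ /derive1_is_derive dg1 _].
    have := is_deriveB dg1 (dpoly (g2 x) 0 (x + h)).
    by rewrite !mul0r addr0.
  have := norm_increment_le_near hK (F' := fun y => g2 y - g2 x) (ltW C0) dR g3P.
  apply: filterS => h; apply: le_trans; rewrite le_eqVlt; apply/orP; left.
  by apply/eqP; congr (`|_|); ring.
have dR : \forall h \near 0, is_derive (x + h) 1
      (fun y => g y - (g1 x * (y - x) + g2 x / 2 * (y - x) ^+ 2))
      (g1 (x + h) - (g1 x + g2 x * (x + h - x))).
  apply: filterS nD => h /hg[/derive1_is_derive dg _ _].
  have := is_deriveB dg (dpoly (g1 x) (g2 x / 2) (x + h)).
  by rewrite divfK ?pnatr_eq0.
exists C => //.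
(* The derivative of the remainder of [g] is the remainder of [g1], already bounded by
   [C * |h| ^+ 2] in [R1]. *)
have H := norm_increment_le_near hK
  (F' := fun y => g1 y - (g1 x + g2 x * (y - x))) (n := 2) (ltW C0) dR.
apply: filterS (H _).
  move=> h; apply: le_trans; rewrite le_eqVlt; apply/orP; left.
  apply/eqP; congr (`|_|); rewrite /g1 /g2; ring.
by apply: filterS R1 => h; rewrite (addrAC x) subrr add0r opprD addrA.
Qed.

(** * Scalar O-estimates and quadratic coefficients *)

Section bigO_scalar.
Context {K : numFieldType} {F : filter_on K}.
Implicit Types f g u v : K -> K^o.

Lemma bigO_mul f g u v : f =O_F u -> g =O_F v ->
  (fun e => f e * g e : K^o) =O_F (fun e => u e * v e : K^o).
Proof.
move=> /eqO_exP[A A0 fA] /eqO_exP[B B0 gB].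
apply/eqO_exP; exists (A * B); first exact: mulr_gt0.
apply: filterS2 fA gB => e fA gB; rewrite !normrM mulrACA.
exact: ler_pM.
Qed.

Lemma bigO_trans f u v : f =O_F u -> u =O_F v -> f =O_F v.
Proof.
move=> /eqO_exP[A A0 fA] /eqO_exP[B B0 uB].
apply/eqO_exP; exists (A * B); first exact: mulr_gt0.
apply: filterS2 fA uB => e /le_trans fA uB; apply: fA.
by rewrite -mulrA ler_wpM2l// ltW.
Qed.

Lemma cvg_bigO1 f (l : K) : f e @[e --> F] --> l -> f =O_F (fun=> 1 : K^o).
Proof.
move=> /cvgrPdist_le/(_ 1 ltr01) fl.
apply/eqO_exP; exists (1 + `|l|); first by rewrite ltr_pwDl.
apply: filterS fl => e; rewrite normr1 mulr1 distrC => fl.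
by rewrite -[f e](subrK l) (le_trans (ler_normD _ _))// lerD2r.
Qed.

Lemma bigO_quadpol (c : K -> 'I_3 -> K) (x : K) :
  (forall i, (fun e => c e i : K^o) =O_F (fun=> 1 : K^o)) ->
  (fun e => quadpol (c e) x : K^o) =O_F (fun=> 1 : K^o).
Proof.
move=> cO; rewrite /quadpol.
have cxO i : (fun e => c e i * x ^+ i : K^o) =O_F (fun=> 1 : K^o).
  have xO : (fun=> x ^+ i : K^o) =O_F (fun=> 1 : K^o).
    by apply: (@cvg_bigO1 _ (x ^+ i)); exact: cvg_cst.
  by have := bigO_mul (cO i) xO; rewrite mulr1.
under eq_fun do rewrite !big_ord_recr big_ord0/= add0r.
by apply: add2O; [apply: add2O|].
Qed.

End bigO_scalar.

Lemma cvg_quadpol (K : numFieldType) (F : set_system K) {FF : Filter F}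
    (c : K -> 'I_3 -> K) (l : 'I_3 -> K) (x : K) :
  (forall i, c e i @[e --> F] --> l i) ->
  quadpol (c e) x @[e --> F] --> quadpol l x.
Proof.
move=> cl; rewrite /quadpol.
under eq_fun do rewrite !big_ord_recr big_ord0/= add0r.
rewrite !big_ord_recr big_ord0/= add0r.
by do 2?[apply: cvgD]; apply: cvgM; do ?[exact: cl|exact: cvg_cst].
Qed.

(** * Algebra of the expanded equation *)

Section qdifference.
Context {K : numFieldType}.
Implicit Types (e x : K) (g : K -> K) (a b : K -> 'I_3 -> K).

(** Substituting the two Taylor polynomials into the equation gives exactly [expanded_lhs], whose
    last term comes from the [e ^+ 2] in [- e + e ^+ 2]. Only the Taylor remainders are left
    over. *)
Lemma qdiff_lhsBexpanded_lhs am ap a0 g e x :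
  qdiff_lhs am ap a0 g e x - expanded_lhs am ap a0 g e x =
  quadpol (am e) x * (g (x / (1 + e)) - taylor_div g e x)
  + quadpol (ap e) x * (g ((1 + e) * x) - taylor_mul g e x).
Proof.
rewrite /qdiff_lhs /expanded_lhs /taylor_div /taylor_mul /quadpol.
by rewrite !big_ord_recr !big_ord0/=; ring.
Qed.

(** The powers of [e] are distributed so that the three quotients with prescribed limits appear as
    coefficients. *)
Lemma expanded_lhs_divX2 am ap a0 g e x : e != 0 ->
  expanded_lhs am ap a0 g e x / e ^+ 2 =
  quadpol (fun i => (am e i + ap e i + a0 e i) / e ^+ 2) x * g x
  + quadpol (fun i => (ap e i - am e i) / e) x * x * derive1 g x
  + quadpol (fun i => (ap e i + am e i) / 2) x * x ^+ 2 * derive1n 2 g x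
  + quadpol (am e) x * x * derive1 g x.
Proof.
move=> e0; rewrite /expanded_lhs /quadpol.
by rewrite !big_ord_recr !big_ord0/=; field.
Qed.

End qdifference.

(** * Limits at the punctured neighbourhood of 0 *)

Lemma cvg_near_eq (K : numFieldType) (F : set_system K) {FF : Filter F}
    (f h : K -> K) (l : K) :
  f e @[e --> F] --> l -> (\forall e \near F, f e = h e) -> h e @[e --> F] --> l.
Proof. by move=> fl fh; apply: cvg_trans fl; exact: near_eq_cvg. Qed.

Section dnbhs0.
Context {K : numFieldType}.

Lemma cvg_id_dnbhs0 : (e : K) @[e --> 0^'] --> (0 : K).
Proof. exact: cvg_within. Qed.

Lemma cvg_onePe : (1 + e : K) @[e --> 0^'] --> (1 : K).
Proof.
rewrite -[X in _ --> X]addr0; apply: cvgD; first exact: cvg_cst.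
exact: cvg_id_dnbhs0.
Qed.

Lemma near_onePe_neq0 : \forall e \near (0 : K)^', 1 + e != 0.
Proof. exact: cvgr_neq0 cvg_onePe (oner_neq0 _). Qed.

Lemma cvg_onePeV : ((1 + e)^-1 : K) @[e --> 0^'] --> (1 : K).
Proof.
rewrite -[X in _ --> X]invr1; apply: cvgV; first exact: oner_neq0.
exact: cvg_onePe.
Qed.

End dnbhs0.

(** * Taylor expansions in [e] of the dilated values and of the equation *)

Section taylor_bigO.
Context {K : numFieldType}.
Context (hK : real_or_complex K) (D : set K) (hD : open D).
Context (g : K -> K) (hg : derivable3 D g) (x : K) (Dx : D x).

(** Covers both dilations: the increment is [u e * e] with [u] constantly [x] for [q * x], and
    [u e = - x / (1 + e)] for [x / q]. *)
Lemma taylor3_bigO (u : K -> K) (l : K) : u e @[e --> 0^'] --> l ->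
  (fun e => g (x + u e * e) - g x - derive1 g x * (u e * e)
    - derive1n 2 g x * (u e * e) ^+ 2 / 2 : K^o) =O_ (0^') (fun e => e ^+ 3 : K^o).
Proof.
move=> ul; have [C C0 gC] := taylor3 hK hD hg Dx.
(* The estimate of [taylor3] is pulled back along this limit. It holds on a full neighbourhood of 0,
   so the increment may vanish, as it does when [x = 0]. *)
have ue0 : u e * e @[e --> 0^'] --> (0 : K).
  by rewrite -[X in _ --> X](mulr0 l); apply: cvgM => //; exact: cvg_id_dnbhs0.
have remO : (fun e => g (x + u e * e) - g x - derive1 g x * (u e * e)
    - derive1n 2 g x * (u e * e) ^+ 2 / 2 : K^o) =O_ (0^') (fun e => (u e * e) ^+ 3 : K^o).
  by apply/eqO_exP; exists C => //; move: (ue0 _ gC);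
    apply: (@filterS _ (0 : K)^') => e; rewrite normrX.
apply: bigO_trans remO _.
have u3 : u e ^+ 3 @[e --> 0^'] --> l ^+ 3 by do !apply: cvgM.
have := bigO_mul (cvg_bigO1 u3) (idO _ (fun e : K => e ^+ 3 : K^o)).
under eq_fun do rewrite -exprMn.
by under [X in _ = the_bigO _ _ _ _ X -> _]eq_fun do rewrite mul1r.
Qed.

Lemma taylor_mul_bigO : (fun e : K => g ((1 + e) * x) - taylor_mul g e x : K^o)
  =O_ (0^') (fun e : K => e ^+ 3 : K^o).
Proof.
have -> : (fun e : K => g ((1 + e) * x) - taylor_mul g e x : K^o) =
    (fun e => g (x + x * e) - g x - derive1 g x * (x * e)
      - derive1n 2 g x * (x * e) ^+ 2 / 2).
  by apply/funext => e; rewrite /taylor_mul (_ : (1 + e) * x = x + x * e); ring.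
exact: (taylor3_bigO (cvg_cst x)).
Qed.

Lemma taylor_div_bigO : (fun e : K => g (x / (1 + e)) - taylor_div g e x : K^o)
  =O_ (0^') (fun e : K => e ^+ 3 : K^o).
Proof.
have uP : - x / (1 + e) @[e --> 0^'] --> - x * 1.
  by apply: cvgM; [exact: cvg_cst|exact: cvg_onePeV].
(* [w e * e ^+ 3] is the error of replacing the increment [- x * e / (1 + e)] by
   [x * (- e + e ^+ 2)] in the linear term and its square by [x ^+ 2 * e ^+ 2] in the quadratic one.
   As [w] converges, it is bounded. *)
pose w e := - derive1 g x * x * (1 + e)^-1
            - derive1n 2 g x * x ^+ 2 / 2 * (2 + e) * (1 + e)^-1 ^+ 2.
have wP : exists l : K, w e @[e --> 0^'] --> l.
  eexists; apply: cvgB; apply: cvgM; first exact: cvg_cst.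
  - exact: cvg_onePeV.
  - apply: cvgM; first exact: cvg_cst.
    by apply: cvgD; [exact: cvg_cst|exact: cvg_id_dnbhs0].
  - by apply: cvgM; exact: cvg_onePeV.
case: wP => l /cvg_bigO1 wO.
have := bigO_mul wO (idO _ (fun e : K => e ^+ 3 : K^o)).
move=> weO.
have [A A0 remA] := (eqO_exP _ _ _).1 (taylor3_bigO uP).
have [B B0 weB] := (eqO_exP _ _ _).1 weO.
apply/eqO_exP; exists (A + B); first exact: addr_gt0.
apply: filterS3 near_onePe_neq0 remA weB => e e1 rA wB.
have -> : g (x / (1 + e)) - taylor_div g e x =
    (g (x + - x / (1 + e) * e) - g x - derive1 g x * (- x / (1 + e) * e)
    - derive1n 2 g x * (- x / (1 + e) * e) ^+ 2 / 2) + w e * e ^+ 3.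
  have -> : x + - x / (1 + e) * e = x / (1 + e) by field.
  by rewrite /taylor_div /w; field.
rewrite (le_trans (ler_normD _ _))// [leRHS]mulrDl lerD//.
by move: wB; rewrite mul1r.
Qed.

End taylor_bigO.

(** Bounded coefficients preserve the order of the two Taylor remainders, which make up the whole
    difference. *)
Lemma qdiff_expanded_bigO (K : numFieldType) (hK : real_or_complex K)
    (D : set K) (hD : open D) (g : K -> K) (hg : derivable3 D g)
    (am ap a0 : K -> 'I_3 -> K) (x : K) :
  (forall i, (fun e : K => am e i : K^o) =O_ (0^') (fun=> 1 : K^o)) ->
  (forall i, (fun e : K => ap e i : K^o) =O_ (0^') (fun=> 1 : K^o)) ->
  D x ->
  (fun e : K => qdiff_lhs am ap a0 g e x - expanded_lhs am ap a0 g e x : K^o)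
    =O_ (0^') (fun e : K => e ^+ 3 : K^o).
Proof.
move=> amO apO Dx.
have O1 := bigO_mul (bigO_quadpol x amO) (taylor_div_bigO hK hD hg Dx).
have O2 := bigO_mul (bigO_quadpol x apO) (taylor_mul_bigO hK hD hg Dx).
under eq_fun do rewrite qdiff_lhsBexpanded_lhs.
have mul1e : (fun e : K => 1 * e ^+ 3 : K^o) = (fun e => e ^+ 3 : K^o).
  by apply/funext => e; rewrite mul1r.
by rewrite mul1e in O1 O2; exact: add2O.
Qed.

(** * Division by [e ^+ 2] and passage to the differential equation *)

Lemma bigO_dnbhs0_cvg0 (K : numFieldType) (f : K -> K) :
  (f : K -> K^o) =O_ (0^') (fun e : K => e ^+ 3 : K^o) ->
  f e / e ^+ 2 @[e --> 0^'] --> (0 : K).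
Proof.
move=> /eqO_exP[C C0 fC]; apply/cvgr0Pnorm_le => eps eps0.
(* For [|e| <= eps / C], the bound [C * |e| ^+ 3] is at most [eps * |e| ^+ 2]. *)
have /cvgr0Pnorm_le/(_ _ (divr_gt0 eps0 C0)) := @cvg_id_dnbhs0 K.
have ne0 : \forall e \near (0 : K)^', e != 0 by exact: nbhs_dnbhs_neq.
apply: filterS3 ne0 fC => e e0 fe.
rewrite (ler_pdivlMr _ _ C0) mulrC => Ce.
rewrite normrM normfV ler_pdivrMr ?normr_gt0 ?expf_neq0// (le_trans fe)//.
by rewrite (exprS e 2) normrM mulrA ler_wpM2r.
Qed.

Section limits.
Context {K : numFieldType}.
Context (am ap a0 : K -> 'I_3 -> K) (b b1 b0 : 'I_3 -> K).
Context (sumP : forall i,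
    (am e i + ap e i + a0 e i) / e ^+ 2 @[e --> 0^'] --> b0 i)
  (subP : forall i, (ap e i - am e i) / e @[e --> 0^'] --> b1 i)
  (avgP : forall i, (ap e i + am e i) / 2 @[e --> 0^'] --> b i).

(** Each coefficient is a combination of the given quotients: [ap] and [am] are the half-sum plus or
    minus the half-difference, and [a0] is the total sum minus twice the half-sum. The difference
    and the total sum tend to 0, being convergent quotients times [e] and [e ^+ 2]. *)
Lemma coef_limits i : [/\ ap e i @[e --> 0^'] --> b i,
                   am e i @[e --> 0^'] --> b i
                 & a0 e i @[e --> 0^'] --> - 2 * b i].
Proof.
have ne0 : \forall e \near (0 : K)^', e != 0 by exact: nbhs_dnbhs_neq.
have id0 := @cvg_id_dnbhs0 K.
have dP : (ap e i - am e i) / e * e / 2 @[e --> 0^'] --> (0 : K).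
  rewrite [X in _ --> X](_ : _ = b1 i * 0 / 2); last by rewrite mulr0 mul0r.
  by apply: cvgM; [exact: cvgM|exact: cvg_cst].
have sP : (am e i + ap e i + a0 e i) / e ^+ 2 * e ^+ 2 @[e --> 0^'] --> (0 : K).
  rewrite [X in _ --> X](_ : _ = b0 i * (0 * 0)); last by rewrite !mulr0.
  by apply: cvgM => //; exact: cvgM.
split.
- apply: (@cvg_near_eq _ _ _
    (fun e => (ap e i + am e i) / 2 + (ap e i - am e i) / e * e / 2)).
    by rewrite -[X in _ --> X]addr0; exact: cvgD.
  by apply: filterS ne0 => e e0; field.
- apply: (@cvg_near_eq _ _ _
    (fun e => (ap e i + am e i) / 2 - (ap e i - am e i) / e * e / 2)).
    by rewrite -[X in _ --> X]subr0; exact: cvgB.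
  by apply: filterS ne0 => e e0; field.
- apply: (@cvg_near_eq _ _ _ (fun e => - 2 * ((ap e i + am e i) / 2)
    + (am e i + ap e i + a0 e i) / e ^+ 2 * e ^+ 2)).
    by rewrite -[X in _ --> X]addr0; apply: cvgD => //; apply: cvgM => //; exact: cvg_cst.
  by apply: filterS ne0 => e e0; field.
Qed.

(** The term carrying [am] alone tends to [b] times [x * g']; joined to the first-order term it
    produces the coefficient [b1 + b]. *)
Lemma expanded_lhs_cvg (g : K -> K) (x : K) :
  expanded_lhs am ap a0 g e x / e ^+ 2 @[e --> 0^'] --> ode_lhs b b1 b0 g x.
Proof.
have amP i : am e i @[e --> 0^'] --> b i by have [] := coef_limits i.
have -> : ode_lhs b b1 b0 g x = quadpol b0 x * g x + quadpol b1 x * x * derive1 g x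
    + quadpol b x * x ^+ 2 * derive1n 2 g x + quadpol b x * x * derive1 g x.
  by rewrite /ode_lhs /quadpol !big_ord_recr !big_ord0/=; ring.
apply: cvg_near_eq; last first.
  apply: filterS (nbhs_dnbhs_neq 0) => e e0.
  by symmetry; exact: expanded_lhs_divX2 e0.
apply: cvgD; [apply: cvgD; [apply: cvgD|]|]; do ?[apply: cvgM]; try exact: cvg_cst;
  exact: cvg_quadpol.
Qed.

End limits.

Lemma qdiff_lhs_cvg (K : numFieldType) (hK : real_or_complex K)
    (D : set K) (hD : open D) (g : K -> K) (hg : derivable3 D g)
    (am ap a0 : K -> 'I_3 -> K) (b b1 b0 : 'I_3 -> K) (x : K) :
  (forall i, (am e i + ap e i + a0 e i) / e ^+ 2 @[e --> 0^'] --> b0 i) ->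
  (forall i, (ap e i - am e i) / e @[e --> 0^'] --> b1 i) ->
  (forall i, (ap e i + am e i) / 2 @[e --> 0^'] --> b i) ->
  D x ->
  qdiff_lhs am ap a0 g e x / e ^+ 2 @[e --> 0^'] --> ode_lhs b b1 b0 g x.
Proof.
move=> sumP subP avgP Dx; have lims := coef_limits sumP subP avgP.
have O3 : (fun e : K => qdiff_lhs am ap a0 g e x - expanded_lhs am ap a0 g e x : K^o)
    =O_ (0^') (fun e : K => e ^+ 3 : K^o).
  (* Convergent coefficients are bounded near 0. *)
  by apply: qdiff_expanded_bigO Dx => // i; have [? ? ?] := lims i;
    apply: (@cvg_bigO1 _ _ _ (b i)).
apply: (@cvg_near_eq _ _ _ (fun e : K => expanded_lhs am ap a0 g e x / e ^+ 2
    + (qdiff_lhs am ap a0 g e x - expanded_lhs am ap a0 g e x) / e ^+ 2)).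
  rewrite -[X in _ --> X]addr0; apply: cvgD; first exact: expanded_lhs_cvg.
  exact: bigO_dnbhs0_cvg0.
by apply: nearW => e; rewrite -mulrDl addrC subrK.
Qed.

Theorem mainTheorem1 (K : numFieldType) (hK : real_or_complex K)
    (D : set K) (hD : open D) (g : K -> K) (hg : derivable3 D g)
    (am ap a0 : K -> 'I_3 -> K) :
  (forall x, D x ->
    (fun e : K => g (x / (1 + e)) - taylor_div g e x : K^o)
      =O_ (0^') (fun e : K => e ^+ 3 : K^o) /\
    (fun e : K => g ((1 + e) * x) - taylor_mul g e x : K^o)
      =O_ (0^') (fun e : K => e ^+ 3 : K^o)) /\
  ((forall i, (fun e : K => am e i : K^o) =O_ (0^') (fun=> 1 : K^o)) ->
   (forall i, (fun e : K => ap e i : K^o) =O_ (0^') (fun=> 1 : K^o)) ->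
   forall x, D x ->
     (fun e : K => qdiff_lhs am ap a0 g e x - expanded_lhs am ap a0 g e x : K^o)
       =O_ (0^') (fun e : K => e ^+ 3 : K^o)) /\
  (forall b b1 b0 : 'I_3 -> K,
    (forall i, (am e i + ap e i + a0 e i) / e ^+ 2 @[e --> 0^'] --> b0 i) ->
    (forall i, (ap e i - am e i) / e @[e --> 0^'] --> b1 i) ->
    (forall i, (ap e i + am e i) / 2 @[e --> 0^'] --> b i) ->
    (forall i, [/\ ap e i @[e --> 0^'] --> b i,
                   am e i @[e --> 0^'] --> b i
                 & a0 e i @[e --> 0^'] --> - 2 * b i]) /\
    (forall x, D x ->
      qdiff_lhs am ap a0 g e x / e ^+ 2 @[e --> 0^'] --> ode_lhs b b1 b0 g x) /\
    ((forall x, D x -> \forall e \near 0^', qdiff_lhs am ap a0 g e x = 0) ->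
     forall x, D x -> ode_lhs b b1 b0 g x = 0)).
Proof.
split.
  by move=> x Dx; split; [exact: (taylor_div_bigO hK hD)|exact: (taylor_mul_bigO hK hD)].
split; first by move=> amO apO x; exact: (qdiff_expanded_bigO hK hD).
move=> b b1 b0 sumP subP avgP.
have qdiffP x : D x ->
    qdiff_lhs am ap a0 g e x / e ^+ 2 @[e --> 0^'] --> ode_lhs b b1 b0 g x.
  exact: (qdiff_lhs_cvg hK hD).
split; first exact: coef_limits.
split=> // sol x Dx.
(* For a solution the quotient is 0 for all small nonzero [e], so uniqueness of limits forces the
   differential equation at [x]. *)
have : qdiff_lhs am ap a0 g e x / e ^+ 2 @[e --> 0^'] --> (0 : K).
  apply: (cvg_near_eq (cvg_cst 0)).
  by apply: filterS (sol x Dx) => e ->; rewrite mul0r.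
by move=> qdiff0; exact: (cvg_unique _ (qdiffP x Dx) qdiff0).
Qed.
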